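(* Let $k\in\mathbb{R}$, let $X$ be a complete $\mathrm{CAT}(k)$ space and let $P$ be a subset of $X$ with diameter less than $D_k/4$. In what follows $u:P\to\mathbb{R}$ and $u':P\to\mathbb{R}$ denote non-negative bounded functions, neither identically $0$; $q_u,q_{u'}$ denote the barycenters of $P$ relative to $u$ and $u'$, and $r_u,r_{u'}$ the baryradii of $P$ relative to $u$ and $u'$. \begin{enumerate} \item For every $\epsilon>0$ there exists $\delta>0$ such that if $u,u'$ satisfy $|u(p)-u'(p)|<\delta$ for every $p\in P$, then $|r_u-r_{u'}|<\epsilon$. \item Given $u$ and $\epsilon>0$, there exists $\delta>0$ such that if $u'$ satisfies $|u(p)-u'(p)|<\delta$ for every $p\in P$, then $d(q_u,q_{u'})<\epsilon$. \item Given $u$ and $\epsilon>0$, there exists $\delta>0$ such that if $f_\delta:P\to X$ is a $\delta$-function, then the barycenter of $f_\delta(P)$ relative to $u$ and the baryradius of $f_\delta(P)$ relative to $u$ are within $\epsilon$ of $q_u$ and $r_u$, respectively, where $u$ is regarded as a function on $f_\delta(P)$ by $u(p')=\sup\{u(p)\mid p\in P,\ f_\delta(p)=p'\}$ for $p'\in f_\delta(P)$. \end{enumerate}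
   Context: For $k>0$ put $D_k=\pi/\sqrt{k}$; for $k\le 0$ put $D_k=\infty$ (so then ''diameter less than $D_k/4$'' means finite diameter). $M_k^2$ is the model surface of constant curvature $k$ (rescaled sphere, Euclidean plane, or rescaled hyperbolic plane). A geodesic metric space $X$ is $\mathrm{CAT}(k)$ if every geodesic triangle in $X$ of perimeter less than $2D_k$ has a comparison triangle in $M_k^2$ (same side lengths) such that distances between points of the triangle are at most the distances between the corresponding comparison points. For $P\subseteq X$ of diameter less than $D_k/4$ and $u:P\to\mathbb{R}$ bounded, non-negative and not identically $0$, the baryradius of $P$ relative to $u$ is $r_u=\inf_{x\in X}\sup\{u(p)d(x,p)\mid p\in P\}$, and the barycenter of $P$ relative to $u$ is the point $q_u\in X$ (which exists and is unique) with $\sup\{u(p)d(q_u,p)\mid p\in P\}=r_u$. A $\delta$-function is a map $f_\delta:P\to X$ such that $d(p,f_\delta(p))<\delta$ for every $p\in P$. *)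

(* Defs.v *)
From HB Require Import structures.
From mathcomp Require Import all_boot all_order all_algebra.
From mathcomp Require Import all_classical all_reals all_analysis.

Set Implicit Arguments.
Unset Strict Implicit.
Unset Printing Implicit Defensive.

Import Order.TTheory GRing.Theory Num.Theory.
Import numFieldNormedType.Exports.

Local Open Scope classical_set_scope.
Local Open Scope ring_scope.

(** Inherits [isPointed] from [completeType], i.e. the space is nonempty. *)
#[short(type="completeMetricType")]
HB.structure Definition CompleteMetric (R : numDomainType) :=
  {T of Complete T & Metric R T}.

Section Geodesics.
Context {R : realType} {T : Type}.
Variable d : T -> T -> R.

(** [c] is only constrained on the interval [0, d x y]. *)
Definition geodesic (x y : T) (c : R -> T) : Prop :=
  [/\ c 0 = x, c (d x y) = y &
    forall s t, 0 <= s <= d x y -> 0 <= t <= d x y -> d (c s) (c t) = `|s - t| ].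

Definition geodesic_space : Prop := forall x y, exists c, geodesic x y c.

(** Side [i] joins vertex [i] to its cyclic successor [ordS i]. *)
Definition side_length (v : 'I_3 -> T) (i : 'I_3) : R := d (v i) (v (ordS i)).

Definition geodesic_triangle (v : 'I_3 -> T) (c : 'I_3 -> R -> T) : Prop :=
  forall i, geodesic (v i) (v (ordS i)) (c i).

Definition perimeter (v : 'I_3 -> T) : R := \sum_i side_length v i.

End Geodesics.

Section ModelSurface.
Context {R : realType}.

Definition dot n (x y : 'rV[R]_n) : R := \sum_i x 0 i * y 0 i.

Definition lorentz (x y : 'rV[R]_3) : R :=
  - (x 0 0 * y 0 0) + \sum_(i < 3 | i != 0) x 0 i * y 0 i.

(** The inverse of cosh on nonnegative reals. *)
Definition arcosh (x : R) : R := ln (x + Num.sqrt (x ^+ 2 - 1)).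

Definition sphere := {x : 'rV[R]_3 | dot x x == 1}.

Definition hyperboloid :=
  {x : 'rV[R]_3 | (lorentz x x == -1) && (0 < x 0 0)}.

Record surface := Surface { point_of :> Type; sdist : point_of -> point_of -> R }.

(** The surface of constant curvature [k]. *)
Definition model_surface (k : R) : surface :=
  if 0 < k then
    Surface (fun x y : sphere => acos (dot (val x) (val y)) / Num.sqrt k)
  else if k == 0 then
    Surface (fun x y : 'rV[R]_2 => Num.sqrt (dot (x - y) (x - y)))
  else
    Surface (fun x y : hyperboloid =>
      arcosh (- lorentz (val x) (val y)) / Num.sqrt (- k)).

(** The number D_k, the diameter of the surface of constant curvature [k]. *)
Definition model_diameter (k : R) : \bar R :=
  if 0 < k then (pi / Num.sqrt k)%:E else +oo%E.

End ModelSurface.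

(** The point [c i s] on side [i] has comparison point [c' i s], at the same
    distance [s] from the initial vertex of the side. *)
Definition CAT {R : realType} (k : R) (X : metricType R) : Prop :=
  let d := @mdist R X in
  let d' := @sdist R (model_surface k) in
  geodesic_space d /\
  forall v c, geodesic_triangle d v c ->
    ((perimeter d v)%:E < 2%:E * model_diameter k)%E ->
    exists v' c', [/\ geodesic_triangle d' v' c',
      forall i, side_length d' v' i = side_length d v i &
      forall i j (s t : R), 0 <= s <= side_length d v i ->
        0 <= t <= side_length d v j ->
        d (c i s) (c j t) <= d' (c' i s) (c' j t) ].

Definition diameter {R : realType} {X : metricType R} (P : set X) : \bar R :=
  ereal_sup [set (mdist p q)%:E | p in P & q in P].

Section Barycenter.
Context {R : realType} {X : completeMetricType R}.
Implicit Types (P : set X) (u : X -> R).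

(** Functions on [P] are represented by functions on [X]; only their values on
    [P] matter. *)
Definition weight P u : Prop :=
  [/\ forall p, P p -> 0 <= u p, [bounded u p | p in P] &
      exists2 p, P p & u p != 0].

Definition weighted_radius P u (x : X) : R :=
  sup [set u p * mdist x p | p in P].

Definition baryradius P u : R := inf (range (weighted_radius P u)).

Definition is_barycenter P u (q : X) : Prop :=
  weighted_radius P u q = baryradius P u.

(** Definite description: the unique barycenter when there is exactly one. *)
Definition barycenter P u : X := get (unique (is_barycenter P u)).

Definition delta_function P (delta : R) (f : X -> X) : Prop :=
  forall p, P p -> mdist p (f p) < delta.

Definition pushforward_weight P (f : X -> X) u (p' : X) : R :=
  sup [set u p | p in P `&` f @^-1` [set p'] ].

End Barycenter.

(* Main.v *)
Require Import Defs.
From HB Require Import structures.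
From mathcomp Require Import all_boot all_order all_algebra.
From mathcomp Require Import all_classical all_reals all_analysis.
From mathcomp Require Import ring lra.
Set Implicit Arguments.
Unset Strict Implicit.
Unset Printing Implicit Defensive.
Import Order.TTheory GRing.Theory Num.Theory.
Import numFieldNormedType.Exports.
Local Open Scope classical_set_scope.
Local Open Scope ring_scope.

(** The theorem rests on uniform convexity of the distance at scales below
    [D_k / 2].  Write [R_u x] for [weighted_radius P u x], so that the
    baryradius [r_u] is the infimum of [R_u].

    Convexity.  In the model surface the distance from [p] to the midpoint [m]
    of [x] and [y] is an explicit function of the sides of the triangle
    [x y p]: on the sphere [x + y] is a multiple of [m] in the ambient space, so
    [cos a + cos b = 2 cos (c / 2) cos D]; the plane and the hyperboloid are
    analogous.  Hence if [p] is within [L <= rho < D_k / 2] of both [x] and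
    [y], and [x], [y] are at least [eps] apart, then [p] is within [L - kappa]
    of [m], where [kappa > 0] depends on [rho] and [eps] only.  The comparison
    axiom carries this over to a CAT(k) space ([CAT_midpoint_contracts]).

    Near-minimizers of [R_u].  Let [Delta < D_k / 4] bound the distances in [P].
    A near-minimizer of [R_u] lies within about [Delta] of a point of [P] whose
    weight is almost maximal, hence within [2 Delta + sigma < D_k / 2] of all
    of [P] ([near_minimizer_localized]): this is where [D_k / 4] comes from.
    If two near-minimizers were [eps] apart, the contraction at their midpoint would
    give it a weighted radius below the infimum; so near-minimizers are close
    to each other ([near_minimizers_close]).  As the space is complete, the
    barycenter exists and is unique ([barycenterP]).

    Stability.  Perturbing [u] by [delta] changes [R_u] by at most [delta * rho]
    at points within [rho] of [P], in particular at both barycenters; moving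
    [P] by [delta] changes [R_u] by at most [M * delta] everywhere, where [M]
    bounds [u].  In both cases the baryradii differ by as little, and the new
    barycenter is a near-minimizer of the old [R_u], so it is close to the old
    barycenter. *)

(** * Medians in the ambient spaces of the model surfaces *)
Section DotProduct.
Context {R : realType} {n : nat}.
Implicit Types x y z m p : 'rV[R]_n.

Lemma dotC x y : dot x y = dot y x.
Proof. by apply: eq_bigr => i _; rewrite mulrC. Qed.

Lemma dotDl x y z : dot (x + y) z = dot x z + dot y z.
Proof. by rewrite -big_split; apply: eq_bigr => i _; rewrite mxE mulrDl. Qed.

Lemma dotZl (a : R) x y : dot (a *: x) y = a * dot x y.
Proof. by rewrite mulr_sumr; apply: eq_bigr => i _; rewrite mxE mulrA. Qed.

Lemma dotDr x y z : dot z (x + y) = dot z x + dot z y.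
Proof. by rewrite ![dot z _]dotC dotDl. Qed.

Lemma dotZr (a : R) x y : dot y (a *: x) = a * dot y x.
Proof. by rewrite ![dot y _]dotC dotZl. Qed.

Lemma dot_ge0 x : 0 <= dot x x.
Proof. by apply: sumr_ge0 => i _; rewrite -expr2 sqr_ge0. Qed.

Lemma dot_eq0 x : dot x x = 0 -> x = 0.
Proof.
move/eqP; rewrite psumr_eq0 => [/allP h|i _]; last by rewrite -expr2 sqr_ge0.
apply/rowP => i; rewrite mxE; apply/eqP.
by have := h i (mem_index_enum i); rewrite /= mulf_eq0 orbb.
Qed.

(** Cauchy-Schwarz for unit vectors; it puts [dot x y] in the domain on which
    [cos] inverts [acos]. *)
Lemma dot_itv x y : dot x x = 1 -> dot y y = 1 -> -1 <= dot x y <= 1.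
Proof.
move=> x1 y1; apply/andP; split.
  by have := dot_ge0 (x + y); rewrite dotDl !dotDr (dotC y x) x1 y1; lra.
have := dot_ge0 (x + (-1) *: y).
by rewrite dotDl !dotDr !dotZl !dotZr (dotC y x) x1 y1; lra.
Qed.

(** With [c = cos (d / 2)], where [d] is the angle between [x] and [y], the
    hypotheses say that [m] is their midpoint.  They force
    [x + y = 2 c m], since the difference has square norm zero. *)
Lemma sphere_median x y m p (c : R) : dot x x = 1 -> dot y y = 1 ->
  dot m m = 1 -> dot x m = c -> dot m y = c -> dot x y = 2 * c ^+ 2 - 1 ->
  dot x p + dot y p = 2 * c * dot m p.
Proof.
move=> x1 y1 m1 xm my xy; pose w := x + y + (- (2 * c)) *: m.
have w0 : w = 0.
  apply: dot_eq0; rewrite !(dotDl, dotDr, dotZl, dotZr).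
  by rewrite (dotC y x) (dotC m x) (dotC y m) x1 y1 m1 xm my xy; ring.
have : dot w p = 0 by rewrite w0 -(scale0r p) dotZl mul0r.
by rewrite /w !dotDl dotZl; lra.
Qed.

(** Here [c] is half the distance from [x] to [y]; the hypotheses force
    [x + y = 2 m] by the parallelogram law, and the conclusion is Apollonius'
    theorem. *)
Lemma plane_median x y m p (c : R) :
  dot (x - y) (x - y) = 4 * c ^+ 2 -> dot (x - m) (x - m) = c ^+ 2 ->
  dot (m - y) (m - y) = c ^+ 2 ->
  dot (x - p) (x - p) + dot (y - p) (y - p) =
    2 * dot (m - p) (m - p) + 2 * c ^+ 2.
Proof.
have dotE (a b : 'rV[R]_n) : dot (a - b) (a - b) = dot a a - 2 * dot a b + dot b b.
  by rewrite -(scaleN1r b) !(dotDl, dotDr, dotZl, dotZr) (dotC b a); ring.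
move=> xy xm my; pose w := x + y + (- 2) *: m.
have w0 : w = 0.
  apply: dot_eq0; rewrite !(dotDl, dotDr, dotZl, dotZr).
  move: xy xm my; rewrite !dotE (dotC y x) (dotC m x) (dotC y m); lra.
have wp : dot w p = 0 by rewrite w0 -(scale0r p) dotZl mul0r.
have ww : dot w (x + y) + 2 * dot w m = 0.
  by rewrite w0 -(scale0r p) !dotZl; lra.
move: wp ww xy xm my.
rewrite /w !dotE !(dotDl, dotDr, dotZl, dotZr) (dotC y x) (dotC m x) (dotC y m).
lra.
Qed.

End DotProduct.

Section LorentzForm.
Context {R : realType}.
Implicit Types x y z w m p : 'rV[R]_3.

Lemma lorentzE x y : lorentz x y = - (x 0 0 * y 0 0) +
  (x 0 (lift ord0 ord0) * y 0 (lift ord0 ord0) +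
   x 0 (lift ord0 (lift ord0 ord0)) * y 0 (lift ord0 (lift ord0 ord0))).
Proof.
by rewrite /lorentz big_mkcond /= !big_ord_recl big_ord0 /= add0r addr0.
Qed.

Lemma lorentzC x y : lorentz x y = lorentz y x.
Proof. by rewrite !lorentzE; ring. Qed.

Lemma lorentzDl x y z : lorentz (x + y) z = lorentz x z + lorentz y z.
Proof. by rewrite !lorentzE !mxE; ring. Qed.

Lemma lorentzZl (a : R) x y : lorentz (a *: x) y = a * lorentz x y.
Proof. by rewrite !lorentzE !mxE; ring. Qed.

Lemma lorentzDr x y z : lorentz z (x + y) = lorentz z x + lorentz z y.
Proof. by rewrite ![lorentz z _]lorentzC lorentzDl. Qed.

Lemma lorentzZr (a : R) x y : lorentz y (a *: x) = a * lorentz y x.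
Proof. by rewrite ![lorentz y _]lorentzC lorentzZl. Qed.

(** The reversed Cauchy-Schwarz inequality; it puts [- lorentz x y] in the
    domain on which [cosh] inverts [arcosh]. *)
Lemma lorentz_leN1 x y : lorentz x x = -1 -> 0 < x 0 0 ->
  lorentz y y = -1 -> 0 < y 0 0 -> lorentz x y <= -1.
Proof.
rewrite !lorentzE; set x1 := x 0 (lift _ _); set x2 := x 0 (lift _ _).
set y1 := y 0 (lift _ _); set y2 := y 0 (lift _ _).
set x0 := x 0 0; set y0 := y 0 0 => xx x0_gt0 yy y0_gt0.
(* Lagrange's identity turns Cauchy-Schwarz for the spatial parts into
   [(x0 ^ 2 - 1) (y0 ^ 2 - 1) = (x0 y0 - 1) ^ 2 - (x0 - y0) ^ 2]. *)
have cs : (x1 * y1 + x2 * y2) ^+ 2 <= (x0 * y0 - 1) ^+ 2.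
  have -> : (x1 * y1 + x2 * y2) ^+ 2 =
      (x1 ^+ 2 + x2 ^+ 2) * (y1 ^+ 2 + y2 ^+ 2) - (x1 * y2 - x2 * y1) ^+ 2.
    by ring.
  have -> : x1 ^+ 2 + x2 ^+ 2 = x0 ^+ 2 - 1 by lra.
  have -> : y1 ^+ 2 + y2 ^+ 2 = y0 ^+ 2 - 1 by lra.
  have := sqr_ge0 (x1 * y2 - x2 * y1); have := sqr_ge0 (x0 - y0); lra.
have x0_ge1 : 1 <= x0.
  rewrite -(@ler_pXn2r _ 2) ?nnegrE ?(ltW x0_gt0) ?(ltW y0_gt0)// expr1n.
  by have := sqr_ge0 x1; have := sqr_ge0 x2; lra.
have y0_ge1 : 1 <= y0.
  rewrite -(@ler_pXn2r _ 2) ?nnegrE ?(ltW x0_gt0) ?(ltW y0_gt0)// expr1n.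
  by have := sqr_ge0 y1; have := sqr_ge0 y2; lra.
have xy_ge1 : 1 <= x0 * y0 by rewrite mulr_ege1.
have : `|x1 * y1 + x2 * y2| <= x0 * y0 - 1.
  by rewrite -(@ler_pXn2r _ 2) ?nnegrE ?subr_ge0// real_normK ?num_real.
by rewrite ler_norml => /andP[_]; lra.
Qed.

(** The form is positive definite on the orthogonal complement of a timelike
    vector [m], so an isotropic vector there vanishes. *)
Lemma lorentz_eq0 w m : lorentz m m = -1 -> lorentz w m = 0 ->
  lorentz w w = 0 -> forall p, lorentz w p = 0.
Proof.
rewrite !lorentzE; set m1 := m 0 (lift _ _); set m2 := m 0 (lift _ _).
set w1 := w 0 (lift _ _); set w2 := w 0 (lift _ _).
set m0 := m 0 0; set w0 := w 0 0 => mm wm ww p.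
have w0_eq0 : w0 = 0.
  apply/eqP; rewrite -sqrf_eq0 eq_le sqr_ge0 andbT.
  have : (w1 * m1 + w2 * m2) ^+ 2 <= (w1 ^+ 2 + w2 ^+ 2) * (m1 ^+ 2 + m2 ^+ 2).
    by have := sqr_ge0 (w1 * m2 - w2 * m1); lra.
  have -> : w1 * m1 + w2 * m2 = w0 * m0 by lra.
  have -> : w1 ^+ 2 + w2 ^+ 2 = w0 ^+ 2 by lra.
  have -> : m1 ^+ 2 + m2 ^+ 2 = m0 ^+ 2 - 1 by lra.
  by lra.
have : w1 ^+ 2 + w2 ^+ 2 == 0 by apply/eqP; move: ww; rewrite w0_eq0; lra.
rewrite paddr_eq0 ?sqr_ge0// !sqrf_eq0 => /andP[/eqP w1_eq0 /eqP w2_eq0].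
by rewrite lorentzE -/w0 -/w1 -/w2 w0_eq0 w1_eq0 w2_eq0; ring.
Qed.

(** As on the sphere, with [c = cosh (d / 2)]: [x + y - 2 c m] is isotropic and
    orthogonal to [m], hence zero. *)
Lemma hyperboloid_median x y m p (c : R) : lorentz x x = -1 ->
  lorentz y y = -1 -> lorentz m m = -1 -> lorentz x m = - c ->
  lorentz m y = - c -> lorentz x y = 1 - 2 * c ^+ 2 ->
  lorentz x p + lorentz y p = 2 * c * lorentz m p.
Proof.
move=> x1 y1 m1 xm my xy; pose w := x + y + (- (2 * c)) *: m.
have wm : lorentz w m = 0.
  by rewrite !(lorentzDl, lorentzZl) (lorentzC y m) xm my m1; ring.
have ww : lorentz w w = 0.
  rewrite /w !(lorentzDl, lorentzDr, lorentzZl, lorentzZr).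
  by rewrite (lorentzC y x) (lorentzC m x) (lorentzC y m) x1 y1 m1 xm my xy; ring.
have := lorentz_eq0 m1 wm ww p.
by rewrite /w !lorentzDl lorentzZl; lra.
Qed.

End LorentzForm.

(** * Quantitative convexity from the median formulas *)

Section TrigonometricEstimates.
Context {R : realType}.
Implicit Types a b : R.

Lemma cosB_le a b : a <= b -> cos a - cos b <= b - a.
Proof.
move=> ab.
have [z _ e] := @MVT_segment _ cos (- sin) _ _ ab
  (fun x _ => is_derive_cos x) (continuous_subspaceT (@continuous_cos R)).
rewrite -opprB e /= mulNr opprK -[leRHS]mul1r ler_wpM2r ?subr_ge0//.
Qed.

Lemma le_cos a b : 0 <= a -> a <= b -> b <= pi -> cos b <= cos a.
Proof.
move=> a0 ab bpi; rewrite leNgt ltr_cos -?leNgt// in_itv/= ?a0 ?bpi ?andbT//=.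
- exact: le_trans a0 ab.
- exact: le_trans ab bpi.
Qed.

Definition cosh a : R := (expR a + expR (- a)) / 2.

Lemma cosh_double a : cosh (2 * a) = 2 * cosh a ^+ 2 - 1.
Proof.
rewrite /cosh -mulrN mulr_natl [2 * - a]mulr_natl !mulr2n !expRD.
have := expRxMexpNx_1 a; set e := expR a; set f := expR (- a) => ef.
have -> : e * e + f * f = (e + f) ^+ 2 - 2 * (e * f) by ring.
by rewrite ef; field.
Qed.

(** For [0 <= a <= b] both factors are visibly nonnegative. *)
Lemma coshB a b : cosh b - cosh a =
  (expR b - expR a) * (1 - expR (- a) * expR (- b)) / 2.
Proof.
rewrite /cosh; have := expRxMexpNx_1 a; have := expRxMexpNx_1 b.
set ea := expR a; set fa := expR (- a).
set eb := expR b; set fb := expR (- b) => hb ha.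
have -> : (eb - ea) * (1 - fa * fb) = eb - ea - fa * (eb * fb) + fb * (ea * fa).
  by ring.
by rewrite ha hb; field.
Qed.

Lemma le_cosh a b : 0 <= a -> a <= b -> cosh a <= cosh b.
Proof.
move=> a0 ab; rewrite -subr_ge0 coshB divr_ge0// mulr_ge0// subr_ge0 ?ler_expR//.
by rewrite -expRD -expR0 ler_expR; lra.
Qed.

Lemma lt_cosh a b : 0 <= a -> a < b -> cosh a < cosh b.
Proof.
move=> a0 ab; rewrite -subr_gt0 coshB divr_gt0// mulr_gt0// subr_gt0 ?ltr_expR//.
by rewrite -expRD -expR0 ltr_expR; lra.
Qed.

Lemma coshB_le a b : 0 <= a -> a <= b -> cosh b - cosh a <= expR b * (b - a).
Proof.
move=> a0 ab; rewrite coshB.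
have eab : expR b - expR a <= expR b * (b - a).
  have := expR_ge1Dx (a - b); have := expR_gt0 b => eb.
  rewrite -(ler_pM2l eb) -expRD [in leRHS]addrC subrK; lra.
apply: le_trans eab; have := expR_ge0 (- a); have := expR_ge0 (- b).
set f := expR _; set g := expR _ => f0 g0.
have := mulr_ge0 f0 g0; have : expR a <= expR b by rewrite ler_expR.
by rewrite -subr_ge0; set D := _ - _ => D0 fg0; have := mulr_ge0 D0 fg0; lra.
Qed.

Lemma cosh0 : cosh 0 = 1.
Proof. by rewrite /cosh oppr0 expR0; field. Qed.

Lemma cosh_ge1 a : 0 <= a -> 1 <= cosh a.
Proof. by move=> a0; rewrite -cosh0 le_cosh. Qed.

Lemma arcosh_ge0 a : 1 <= a -> 0 <= arcosh a.
Proof. by move=> a1; rewrite ln_ge0// (le_trans a1)// lerDl sqrtr_ge0. Qed.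

Lemma arcoshK a : 1 <= a -> cosh (arcosh a) = a.
Proof.
move=> a1; rewrite /cosh /arcosh expRN.
have s0 := sqrtr_ge0 (a ^+ 2 - 1); have a2 : 0 <= a ^+ 2 - 1.
  by rewrite subr_ge0 exprn_ege1.
have := sqr_sqrtr a2; set s := Num.sqrt _ in s0 * => s2.
have as0 : 0 < a + s by lra.
rewrite lnK ?posrE//.
have -> : (a + s)^-1 = a - s; last by field.
apply: (mulfI (lt0r_neq0 as0)); rewrite divff ?lt0r_neq0//.
by have -> : (a + s) * (a - s) = a ^+ 2 - s ^+ 2 by [ring]; rewrite s2; ring.
Qed.

(** [a], [b], [c] are the sides of a spherical triangle and [D] is its median
    onto [c].  As [cos a] and [cos b] are at least [cos L], the formula gives
    [cos D >= cos L / cos (c / 2) >= cos L / cos (e / 2)], which exceeds [cos L]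
    by a fixed amount because [cos L >= cos rho > 0]; and [cos] is
    1-Lipschitz. *)
Lemma cos_median_contracts (rho e : R) : 0 < e -> e <= rho -> rho < pi / 2 ->
  exists2 kappa : R, 0 < kappa & forall a b c D L : R,
    cos a + cos b = 2 * cos (c / 2) * cos D ->
    0 <= a <= L -> 0 <= b <= L -> L <= rho -> e <= c <= pi -> 0 <= D <= pi ->
    D <= L - kappa.
Proof.
move=> e0 e_rho rho_pi; pose q := cos (e / 2).
have q0 : 0 < q by apply: cos_gt0_pihalf; lra.
have q1 : q < 1 by rewrite -cos0 ltr_cos ?in_itv/=; lra.
have crho : 0 < cos rho by apply: cos_gt0_pihalf; lra.
have qi0 : 0 < q^-1 - 1 by rewrite subr_gt0 invf_gt1.
exists (cos rho * (q^-1 - 1)); first by rewrite mulr_gt0.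
move=> a b c D L med /andP[a0 aL] /andP[b0 bL] Lrho /andP[ec cpi] /andP[D0 Dpi].
have Lpi : L <= pi by clear -Lrho rho_pi e0 e_rho; lra.
have rhopi : rho <= pi by clear -rho_pi e0 e_rho; lra.
have cosa : cos L <= cos a by apply: le_cos.
have cosb : cos L <= cos b by apply: le_cos.
have cosL : cos rho <= cos L by apply: le_cos => //; exact: le_trans aL.
have cosc0 : 0 <= cos (c / 2).
  by apply: cos_ge0_pihalf; clear -ec cpi e0; lra.
have coscq : cos (c / 2) <= q.
  by apply: le_cos; clear -ec cpi e0; lra.
have L0 : 0 < cos L := lt_le_trans crho cosL.
have cosD0 : 0 < cos D.
  rewrite ltNge; apply/negP => cD0; have := mulr_ge0_le0 cosc0 cD0.
  by clear -med cosa cosb L0; lra.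
have LqD : cos L <= q * cos D.
  have := ler_wpM2r (ltW cosD0) coscq; clear -med cosa cosb; lra.
have gain : cos L + cos rho * (q^-1 - 1) <= cos D.
  have h1 : cos L * q^-1 <= cos D by rewrite ler_pdivrMr// mulrC.
  have := ler_wpM2r (ltW qi0) cosL; clear -h1; lra.
have kappa0 := mulr_gt0 crho qi0.
have DL : D <= L.
  rewrite leNgt; apply/negP => LD.
  have : cos D <= cos L by apply: le_cos => //; [exact: le_trans aL | exact: ltW].
  by clear -gain kappa0; lra.
by have := cosB_le DL; clear -gain; lra.
Qed.

(** The hyperbolic version: [cosh L >= cosh (e / 2) * cosh D] exceeds [cosh D]
    by at least [cosh (e / 2) - 1], and [cosh] is Lipschitz with constant
    [expR rho] on the interval from 0 to [rho]. *)
Lemma cosh_median_contracts (rho e : R) : 0 < e ->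
  exists2 kappa : R, 0 < kappa & forall a b c D L : R,
    cosh a + cosh b = 2 * cosh (c / 2) * cosh D ->
    0 <= a <= L -> 0 <= b <= L -> L <= rho -> e <= c -> 0 <= D ->
    D <= L - kappa.
Proof.
move=> e0; pose q := cosh (e / 2).
have q1 : 1 < q by rewrite -cosh0 lt_cosh// divr_gt0.
have C0 : 0 < expR rho := expR_gt0 _.
exists ((q - 1) / expR rho); first by rewrite divr_gt0 ?subr_gt0.
move=> a b c D L med /andP[a0 aL] /andP[b0 bL] Lrho ec D0.
have cosha : cosh a <= cosh L by apply: le_cosh.
have coshb : cosh b <= cosh L by apply: le_cosh.
have coshcq : q <= cosh (c / 2) by apply: le_cosh; clear -e0 ec; lra.
have coshD1 := cosh_ge1 D0.
have gain : cosh D + (q - 1) <= cosh L.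
  have h1 : q * cosh D <= cosh (c / 2) * cosh D.
    by rewrite ler_wpM2r// (le_trans _ coshD1).
  have h2 : (q - 1) * 1 <= (q - 1) * cosh D by rewrite ler_wpM2l// subr_ge0 ltW.
  by move: h1 h2; clear -med cosha coshb; lra.
have DL : D <= L.
  rewrite leNgt; apply/negP => LD.
  have : cosh L <= cosh D by apply: le_cosh (ltW LD); exact: le_trans aL.
  by clear -gain q1; lra.
have CL : expR L * (L - D) <= expR rho * (L - D).
  by rewrite ler_wpM2r ?subr_ge0// ler_expR.
rewrite lerBrDl -lerBrDr ler_pdivrMr//.
by have := coshB_le D0 DL; clear -CL gain; lra.
Qed.

End TrigonometricEstimates.

(** * Midpoint contraction in the model surfaces *)

Section MidpointContraction.
Context {R : realType}.

Definition midpoint {T : Type} (d : T -> T -> R) (x y m : T) : Prop :=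
  d x m = d x y / 2 /\ d m y = d x y / 2.

(** Uniform convexity: the gain [kappa] may depend on the scale [rho] and on the
    separation [eps], but not on the triangle. *)
Definition contracts_midpoints (S : @surface R) (rho eps : R) : Prop :=
  exists2 kappa : R, 0 < kappa &
    forall (x y m p : S) (L : R), midpoint (@sdist R S) x y m ->
      sdist x p <= L -> sdist y p <= L -> L <= rho -> eps <= sdist x y ->
      sdist m p <= L - kappa.

Lemma sphere_contracts_midpoints (k rho eps : R) : 0 < k ->
  0 < rho -> 2 * rho < pi / Num.sqrt k -> 0 < eps ->
  contracts_midpoints (Surface (fun x y : @sphere R =>
    acos (dot (val x) (val y)) / Num.sqrt k)) rho eps.
Proof.
move=> k0 rho0; set s := Num.sqrt k; have s0 : 0 < s by rewrite sqrtr_gt0.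
rewrite ltr_pdivlMr// => rho_pi eps0.
(* The minimum with [rho] keeps the constant meaningful when [eps > 2 * rho], a
   case that the triangle inequality would exclude. *)
have [|||kappa kappa0 hk] := @cos_median_contracts R (rho * s) (Num.min eps rho * s).
- by rewrite mulr_gt0// lt_min eps0.
- by rewrite ler_pM2r// ge_min lexx orbT.
- by rewrite ltr_pdivlMr// mulrC mulrA.
exists (kappa / s); first by rewrite divr_gt0.
move=> x y m p L [/=].
have dotI (a b : @sphere R) : -1 <= dot (val a) (val b) <= 1.
  by apply: dot_itv; apply/eqP; [exact: (valP a)|exact: (valP b)].
have cosd (a b : @sphere R) :
    cos (acos (dot (val a) (val b)) / s * s) = dot (val a) (val b).
  by rewrite divfK ?gt_eqF// acosK ?in_itv/= ?dotI.
have dI (a b : @sphere R) : 0 <= acos (dot (val a) (val b)) / s * s <= pi.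
  by rewrite divfK ?gt_eqF// acos_ge0 ?acos_lepi.
have := (dI x y, dI m p).
have := (cosd x y, cosd x m, cosd m y, cosd x p, cosd y p, cosd m p).
have [/andP[a0 _] /andP[b0 _]] := (dI x p, dI y p); move: a0 b0.
set c := acos (dot (val x) (val y)) / s; set a := acos (dot (val x) (val p)) / s.
set b := acos (dot (val y) (val p)) / s; set D := acos (dot (val m) (val p)) / s.
move=> a0 b0 [[[[[cc cxm] cmy] ca] cb] cD] [/andP[_ cpi] Dpi].
move=> xm my aL bL L_rho eps_c; rewrite xm in cxm; rewrite my in cmy.
rewrite -(ler_pM2r s0) mulrBl (divfK (lt0r_neq0 s0) kappa).
apply: (hk (a * s) (b * s) (c * s) (D * s) (L * s));
  rewrite ?ler_pM2r// ?a0 ?b0 ?cpi ?andbT//.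
- rewrite ca cb cD; apply: sphere_median.
  + exact/eqP/(valP x).
  + exact/eqP/(valP y).
  + exact/eqP/(valP m).
  + by rewrite -cxm mulrAC.
  + by rewrite -cmy mulrAC.
  + have -> : dot (val x) (val y) = cos ((c * s / 2) *+ 2).
      by rewrite -cc mulr2n; congr cos; field.
    by rewrite cos_mulr2n mulr_natl.
- by rewrite (le_trans _ eps_c)// ge_min lexx.
Qed.

Lemma plane_contracts_midpoints (rho eps : R) : 0 < rho -> 0 < eps ->
  contracts_midpoints (Surface (fun x y : 'rV[R]_2 =>
    Num.sqrt (dot (x - y) (x - y)))) rho eps.
Proof.
move=> rho0 eps0; exists (eps ^+ 2 / (8 * rho)).
  by rewrite divr_gt0 ?exprn_gt0 ?mulr_gt0.
move=> x y m p L [/=].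
have dE (a b : 'rV[R]_2) :
    dot (a - b) (a - b) = Num.sqrt (dot (a - b) (a - b)) ^+ 2.
  by rewrite sqr_sqrtr// dot_ge0.
set c := Num.sqrt (dot (x - y) _) => xm my; set a := Num.sqrt _ => aL.
set b := Num.sqrt _ => bL L_rho eps_c; set D := Num.sqrt _.
have D0 : 0 <= D := sqrtr_ge0 _.
have a0 : 0 <= a := sqrtr_ge0 _.
have b0 : 0 <= b := sqrtr_ge0 _.
have med : a ^+ 2 + b ^+ 2 = 2 * D ^+ 2 + 2 * (c / 2) ^+ 2.
  rewrite /a /b /D -!dE; apply: plane_median.
  - by rewrite dE -/c; field.
  - by rewrite dE xm.
  - by rewrite dE my.
have a2 : a ^+ 2 <= L ^+ 2 by rewrite ler_pXn2r ?nnegrE// (le_trans a0).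
have b2 : b ^+ 2 <= L ^+ 2 by rewrite ler_pXn2r ?nnegrE// (le_trans a0).
have c2 : eps ^+ 2 <= c ^+ 2 by rewrite ler_pXn2r ?nnegrE ?(ltW eps0) ?sqrtr_ge0.
have e2 : 0 < eps ^+ 2 by rewrite exprn_gt0.
have L0 := le_trans a0 aL.
have DL : D <= L by rewrite -(@ler_pXn2r _ 2) ?nnegrE ?L0 ?D0//; lra.
rewrite lerBrDl -lerBrDr ler_pdivrMr ?mulr_gt0//.
have : (L - D) * (L + D) <= (L - D) * (2 * rho) by rewrite ler_wpM2l; lra.
by lra.
Qed.

Lemma hyperboloid_contracts_midpoints (k rho eps : R) : k < 0 ->
  0 < rho -> 0 < eps ->
  contracts_midpoints (Surface (fun x y : @hyperboloid R =>
    arcosh (- lorentz (val x) (val y)) / Num.sqrt (- k))) rho eps.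
Proof.
move=> k0 rho0 eps0; set s := Num.sqrt _.
have s0 : 0 < s by rewrite sqrtr_gt0 oppr_gt0.
have [|kappa kappa0 hk] := @cosh_median_contracts R (rho * s) (eps * s).
  by rewrite mulr_gt0.
exists (kappa / s); first by rewrite divr_gt0.
move=> x y m p L [/=].
have lorI (a b : @hyperboloid R) : 1 <= - lorentz (val a) (val b).
  have /andP[/eqP aa a0] := valP a; have /andP[/eqP bb b0] := valP b.
  by rewrite lerNr lorentz_leN1.
have coshd (a b : @hyperboloid R) :
    cosh (arcosh (- lorentz (val a) (val b)) / s * s) = - lorentz (val a) (val b).
  by rewrite divfK ?gt_eqF// arcoshK.
have d0 (a b : @hyperboloid R) : 0 <= arcosh (- lorentz (val a) (val b)) / s * s.
  by rewrite divfK ?gt_eqF// arcosh_ge0.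
have := (d0 x p, d0 y p, d0 m p).
have := (coshd x y, coshd x m, coshd m y, coshd x p, coshd y p, coshd m p).
set c := arcosh (- lorentz (val x) (val y)) / s.
set a := arcosh (- lorentz (val x) (val p)) / s.
set b := arcosh (- lorentz (val y) (val p)) / s.
set D := arcosh (- lorentz (val m) (val p)) / s.
move=> [[[[[cc cxm] cmy] ca] cb] cD] [[a0 b0] D0].
move=> xm my aL bL L_rho eps_c; rewrite xm in cxm; rewrite my in cmy.
rewrite -(ler_pM2r s0) mulrBl (divfK (lt0r_neq0 s0) kappa).
apply: (hk (a * s) (b * s) (c * s) (D * s) (L * s));
  rewrite ?ler_pM2r// ?a0 ?b0//.
rewrite ca cb cD -opprD.
rewrite (@hyperboloid_median _ _ _ (val m) _ (cosh (c * s / 2))).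
- by rewrite mulrN.
- by have /andP[/eqP] := valP x.
- by have /andP[/eqP] := valP y.
- by have /andP[/eqP] := valP m.
- by rewrite mulrAC cxm opprK.
- by rewrite mulrAC cmy opprK.
- rewrite -[LHS]opprK -cc (_ : c * s = 2 * (c * s / 2)); last by field.
  by rewrite cosh_double [2 * (c * s / 2)]mulrCA divff// mulr1; ring.
Qed.

Lemma model_contracts_midpoints (k rho eps : R) : 0 < rho ->
  ((2 * rho)%:E < model_diameter k)%E -> 0 < eps ->
  contracts_midpoints (model_surface k) rho eps.
Proof.
rewrite /model_diameter /model_surface => rho0 rhok eps0; case: ifPn rhok => k0.
  by rewrite lte_fin => rhok; exact: sphere_contracts_midpoints.
case: ifPn => [_ _|kn0 _]; first exact: plane_contracts_midpoints.
by apply: hyperboloid_contracts_midpoints => //; rewrite lt_neqAle kn0 leNgt.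
Qed.

Lemma model_dist_sym (k : R) (x y : model_surface k) : sdist x y = sdist y x.
Proof.
move: x y; rewrite /model_surface; case: ifP => _.
  by move=> x y /=; rewrite dotC.
case: ifP => _ x y /=; last by rewrite lorentzC.
by rewrite -opprB -scaleN1r dotZl dotZr mulrA mulrNN !mul1r.
Qed.

End MidpointContraction.

(** * Midpoint contraction in CAT(k) spaces *)

Section ComparisonGeometry.
Context {R : realType}.

Lemma lt_perimeter_bound (k rho s : R) : s <= 4 * rho ->
  ((2 * rho)%:E < model_diameter k)%E -> (s%:E < 2%:E * model_diameter k)%E.
Proof.
move=> s_rho; rewrite /model_diameter; case: ifP => _.
  by rewrite -EFinM !lte_fin; lra.
by rewrite gt0_muley ?lte_fin ?ltry.
Qed.

(** A comparison triangle for [x], [y], [p] has the same sides, and the distance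
    from its midpoint to its third vertex bounds [mdist m p].  The point [m] is
    chosen before [p], so that it serves for all points of a set at once. *)
Lemma CAT_midpoint_contracts (k : R) (X : metricType R) (rho eps : R) :
  CAT k X -> 0 < rho -> ((2 * rho)%:E < model_diameter k)%E -> 0 < eps ->
  exists2 kappa : R, 0 < kappa & forall x y : X, exists m : X,
    forall (p : X) (L : R), mdist x p <= L -> mdist y p <= L -> L <= rho ->
      eps <= mdist x y -> mdist m p <= L - kappa.
Proof.
move=> [geo cat] rho0 rhok eps0.
have [kappa kappa0 hk] := model_contracts_midpoints rho0 rhok eps0.
exists kappa => // x y; have [cxy gxy] := geo x y.
exists (cxy (mdist x y / 2)) => p L xpL ypL Lrho exy.
have [cyp gyp] := geo y p; have [cpx gpx] := geo p x.
pose v (i : 'I_3) := nth p [:: x; y; p] i.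
pose c (i : 'I_3) := nth cpx [:: cxy; cyp; cpx] i.
have tri : geodesic_triangle (@mdist R X) v c.
  by move=> [[|[|[|//]]] lti]; [exact: gxy|exact: gyp|exact: gpx].
(* Two sides are at most [L], hence the third at most [2 * L], so the perimeter
   is at most [4 * rho]. *)
have [|v' [c' [tri' side' cmp]]] := cat v c tri.
  apply: lt_perimeter_bound rhok; rewrite /perimeter !big_ord_recl big_ord0.
  rewrite /side_length /v /= addr0.
  have := metric_triangle x p y; rewrite (metric_sym p y) (metric_sym p x); lra.
pose i0 : 'I_3 := ord0; pose i1 : 'I_3 := ordS i0; pose i2 : 'I_3 := ordS i1.
have i20 : ordS i2 = i0 by apply: val_inj.
have d0 := mdist_ge0 x y.
have s0 : sdist (v' i0) (v' i1) = mdist x y := side' i0.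
have s1 : sdist (v' i1) (v' i2) = mdist y p := side' i1.
have s2 : sdist (v' i2) (v' i0) = mdist p x by rewrite -i20; exact: side' i2.
have [c00 c01 c0] := tri' i0; have [c20 _ _] := tri' i2; rewrite s0 in c01 c0.
have mid : midpoint (@sdist R _) (v' i0) (v' i1) (c' i0 (mdist x y / 2)).
  split; first by rewrite -{1}c00 c0 ?s0 ?sub0r ?normrN ?ger0_norm; lra.
  by rewrite -{1}c01 c0 ?s0 ?ler0_norm; lra.
have [c2p _ _] := gpx.
have : mdist (cxy (mdist x y / 2)) (cpx 0) <= sdist (c' i0 (mdist x y / 2)) (c' i2 0).
  apply: (cmp i0 i2).
  - by rewrite /side_length /v /=; lra.
  - by rewrite /side_length /v /= lexx mdist_ge0.
rewrite c2p c20 => /le_trans; apply.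
apply: (hk _ _ _ _ _ mid) => //; rewrite ?s0 ?s1//.
by rewrite model_dist_sym s2 metric_sym.
Qed.

End ComparisonGeometry.

(** * Weighted radii and their near-minimizers *)

Section WeightedRadius.
Context {R : realType} {X : completeMetricType R}.
Implicit Types (P : set X) (u : X -> R) (x y q : X).

Definition spread P (Delta : R) : Prop :=
  forall p q, P p -> P q -> mdist p q <= Delta.

Lemma weight_bound P u : weight P u ->
  exists2 M, 0 < M & forall p, P p -> u p <= M.
Proof.
move=> [_ /ex_strict_bound_gt0[M M0 uM] _]; exists M => // p Pp.
exact: le_trans (ler_norm _) (ltW (uM p Pp)).
Qed.

Lemma weight_gt0 P u : weight P u -> exists2 p, P p & 0 < u p.
Proof. by move=> [u0 _ [p Pp up]]; exists p; rewrite // lt0r up u0. Qed.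

Lemma weighted_radius_le P u x (r : R) : weight P u ->
  (forall p, P p -> u p * mdist x p <= r) -> weighted_radius P u x <= r.
Proof.
move=> [_ _ [p0 Pp0 _]] h; apply: ge_sup; first by exists (u p0 * mdist x p0), p0.
by move=> _ [p Pp <-]; exact: h.
Qed.

Lemma le_weighted_radius P u (Delta : R) x p : weight P u -> spread P Delta ->
  P p -> u p * mdist x p <= weighted_radius P u x.
Proof.
move=> wu sP Pp; have [M M0 uM] := weight_bound wu; have [u0 _ _] := wu.
apply: ub_le_sup; last by exists p.
exists (M * (mdist x p + Delta)) => _ [p' Pp' <-].
apply: ler_pM; rewrite ?u0 ?mdist_ge0 ?uM//.
by apply: le_trans (metric_triangle x p p') _; rewrite lerD2l sP.
Qed.

Lemma baryradius_le P u (Delta : R) x : weight P u -> spread P Delta ->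
  baryradius P u <= weighted_radius P u x.
Proof.
move=> wu sP; apply: ge_inf; last by exists x.
have [p Pp up] := weight_gt0 wu; exists 0 => _ [y _ <-].
by apply: le_trans (le_weighted_radius y wu sP Pp); rewrite mulr_ge0 ?mdist_ge0// ltW.
Qed.

Lemma weighted_radius_lipschitz P u (Delta M : R) x y : weight P u ->
  spread P Delta -> (forall p, P p -> u p <= M) ->
  weighted_radius P u x <= weighted_radius P u y + M * mdist x y.
Proof.
move=> wu sP uM; apply: weighted_radius_le => // p Pp; have [u0 _ _] := wu.
have := le_weighted_radius y wu sP Pp.
have := ler_wpM2l (u0 p Pp) (metric_triangle x y p).
by have := ler_wpM2r (mdist_ge0 x y) (uM p Pp); lra.
Qed.

(** Let [p1] be a point of [P] of almost maximal weight.  The weighted radius at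
    [p1] is at most [S * Delta], where [S] is the supremum of the weights, so a
    near-minimizer satisfies [u p1 * mdist x p1 <= S * Delta + eta], which
    places it within [Delta + sigma] of [p1]. *)
Lemma near_minimizer_localized P u (Delta sigma : R) : weight P u ->
  spread P Delta -> 0 < sigma -> exists2 eta : R, 0 < eta &
    forall x, weighted_radius P u x <= baryradius P u + eta ->
      forall p, P p -> mdist x p <= 2 * Delta + sigma.
Proof.
move=> wu sP sigma0; have [u0 _ _] := wu.
have [p0 Pp0 up0] := weight_gt0 wu; have [M M0 uM] := weight_bound wu.
have Delta0 : 0 <= Delta by rewrite -(mdistxx p0) sP.
pose S := sup [set u p | p in P].
have hsup : has_sup [set u p | p in P].
  by split; [exists (u p0), p0|exists M => _ [p Pp <-]; exact: uM].
have uS p : P p -> u p <= S by move=> Pp; apply: sup_upper_bound => //; exists p.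
have S0 : 0 < S := lt_le_trans up0 (uS _ Pp0).
have Ds0 : 0 < Delta + sigma / 2 by lra.
have gap : 0 < S * (sigma / 2) / (Delta + sigma / 2).
  by rewrite divr_gt0// mulr_gt0// divr_gt0.
have [_ [p1 Pp1 <-] up1] := sup_adherent gap hsup.
have {gap} up1' : S * Delta < u p1 * (Delta + sigma / 2).
  rewrite -ltr_pdivrMr//; apply: le_lt_trans up1; rewrite -/S.
  by rewrite le_eqVlt; apply/orP; left; apply/eqP; field; lra.
have u10 : 0 < u p1.
  by rewrite -(pmulr_lgt0 _ Ds0); apply: le_lt_trans up1'; rewrite mulr_ge0// ltW.
exists (u p1 * (sigma / 2)); first by rewrite mulr_gt0// divr_gt0.
move=> x xr p Pp.
have rS : baryradius P u <= S * Delta.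
  apply: le_trans (baryradius_le p1 wu sP) _.
  apply: weighted_radius_le => // p' Pp'.
  by apply: ler_pM; rewrite ?u0 ?mdist_ge0 ?uS ?sP.
have xp1 : mdist x p1 <= Delta + sigma.
  by rewrite -(ler_pM2l u10); have := le_weighted_radius x wu sP Pp1; lra.
by have := metric_triangle x p1 p; have := sP _ _ Pp1 Pp; lra.
Qed.

End WeightedRadius.

(** * Existence and uniqueness of the barycenter *)

Section Barycenters.
Context {R : realType} {X : completeMetricType R} (k : R) (hX : CAT k X).
Implicit Types (P : set X) (u : X -> R) (x y q : X).

(** The margin [sigma] leaves room for localizing near-minimizers up to an error
    and for displacing the points of [P]. *)
Definition small_spread P (Delta sigma : R) : Prop :=
  [/\ spread P Delta, 0 <= Delta, 0 < sigma &
      ((2 * (2 * Delta + sigma))%:E < model_diameter k)%E].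

(** Were two near-minimizers [eps] apart, each point of [P] would be closer to
    their midpoint [m] than to the farther of the two by a factor
    [1 - kappa / rho], so [r <= (1 - kappa / rho) * (r + eta)], where [r] is the
    baryradius.  As [r + eta] is bounded below through a point [p0] of positive
    weight, this fails for small [eta]; arguing through [p0] also covers the
    case of baryradius zero. *)
Lemma near_minimizers_close P u (Delta sigma eps : R) : weight P u ->
  small_spread P Delta sigma -> 0 < eps -> exists2 eta : R, 0 < eta &
    forall x y, weighted_radius P u x <= baryradius P u + eta ->
      weighted_radius P u y <= baryradius P u + eta -> mdist x y < eps.
Proof.
move=> wu [sP Delta0 sigma0 hk] eps0; have [u0 _ _] := wu.
set rho := 2 * Delta + sigma in hk; have rho0 : 0 < rho by rewrite /rho; lra.
have [eta1 eta10 loc] := near_minimizer_localized wu sP sigma0.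
have [kappa kappa0 contr] := CAT_midpoint_contracts hX rho0 hk eps0.
have [p0 Pp0 up0] := weight_gt0 wu.
have t0 : 0 < kappa / rho by rewrite divr_gt0.
have c0 : 0 < kappa / rho * (u p0 * (eps / 4)).
  by rewrite mulr_gt0// mulr_gt0// divr_gt0.
exists (Num.min eta1 (kappa / rho * (u p0 * (eps / 4)))).
  by rewrite lt_min eta10.
set eta := Num.min _ _; have eta_le1 : eta <= eta1 by rewrite ge_min lexx.
have eta_le2 : eta <= kappa / rho * (u p0 * (eps / 4)).
  by rewrite ge_min lexx orbT.
move=> x y xr yr; rewrite ltNge; apply/negP => exy.
set r := baryradius P u in xr yr.
have xloc := loc x (le_trans xr _); have yloc := loc y (le_trans yr _).
rewrite !lerD2l in xloc yloc.
have [m hm] := contr x y.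
pose L p := Num.max (mdist x p) (mdist y p).
have xL p : mdist x p <= L p by rewrite le_max lexx.
have yL p : mdist y p <= L p by rewrite le_max lexx orbT.
have Lrho p : P p -> L p <= rho.
  by move=> Pp; rewrite ge_max xloc// yloc.
have mL p : P p -> mdist m p <= (1 - kappa / rho) * L p.
  move=> Pp; have := hm p _ (xL p) (yL p) (Lrho p Pp) exy.
  have : kappa / rho * L p <= kappa.
    by rewrite mulrAC ler_pdivrMr// ler_wpM2l ?Lrho// ltW.
  lra.
have uL p : P p -> u p * L p <= r + eta.
  move=> Pp; rewrite /L maxEle; case: ifP => _.
    exact: le_trans (le_weighted_radius y wu sP Pp) yr.
  exact: le_trans (le_weighted_radius x wu sP Pp) xr.
(* The gain [kappa] cannot exceed [rho], because [mdist m p0] is nonnegative. *)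
have theta0 : 0 <= 1 - kappa / rho.
  rewrite subr_ge0 ler_pdivrMr// mul1r.
  have := hm p0 _ (xL p0) (yL p0) (Lrho p0 Pp0) exy.
  by have := mdist_ge0 m p0; have := Lrho p0 Pp0; lra.
have rm : r <= (1 - kappa / rho) * (r + eta).
  apply: le_trans (baryradius_le m wu sP) _.
  apply: weighted_radius_le => // p Pp.
  have := ler_wpM2l theta0 (uL p Pp); have := ler_wpM2l (u0 p Pp) (mL p Pp).
  by clear; lra.
have lower : u p0 * (eps / 2) <= r + eta.
  apply: le_trans (uL p0 Pp0); rewrite ler_pM2l//.
  have := metric_triangle x p0 y; rewrite (metric_sym p0 y).
  by have := xL p0; have := yL p0; clear -exy; lra.
have := ler_wpM2l (ltW t0) lower; clear -rm eta_le2 c0; lra.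
Qed.

Lemma minimizing_filter P u (Delta : R) : weight P u -> spread P Delta ->
  ProperFilter (filter_from (fun eta : R => 0 < eta)
    (fun eta => [set x | weighted_radius P u x <= baryradius P u + eta])).
Proof.
move=> wu sP; apply: filter_from_proper => [|eta eta0].
  apply: filter_from_filter; first by exists 1.
  move=> i j i0 j0; exists (Num.min i j); first by rewrite lt_min i0.
  by move=> x xr; split; apply: le_trans xr _; rewrite lerD2l ge_min lexx ?orbT.
have hinf : has_inf (range (weighted_radius P u)).
  split; first by exists (weighted_radius P u point), point.
  exists 0 => _ [y _ <-]; have [u0 _ [p Pp _]] := wu.
  by apply: le_trans (le_weighted_radius y wu sP Pp); rewrite mulr_ge0 ?u0 ?mdist_ge0.
by have [_ [x _ <-] /ltW xr] := inf_adherent eta0 hinf; exists x.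
Qed.

(** The filter of near-minimizers is Cauchy by [near_minimizers_close], and the
    weighted radius is continuous. *)
Lemma barycenter_exists P u (Delta sigma : R) : weight P u ->
  small_spread P Delta sigma -> exists q, is_barycenter P u q.
Proof.
move=> wu tP; have [sP _ _ _] := tP.
pose N (eta : R) := [set x | weighted_radius P u x <= baryradius P u + eta].
pose F := filter_from (fun eta : R => 0 < eta) N.
have FF : ProperFilter F := minimizing_filter wu sP.
have /cauchy_cvg/cvg_ex[q /= Fq] : cauchy F.
  apply: cauchy_exP => eps eps0.
  have [eta eta0 close] := near_minimizers_close wu tP eps0.
  have [x xr] : N eta !=set0 by apply: (@filter_ex _ F); exists eta.
  exists x; exists eta => // y yr; rewrite ballEmdist/=; exact: close.
exists q; apply/eqP; rewrite /is_barycenter eq_le (baryradius_le q wu sP) andbT.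
have [M M0 uM] := weight_bound wu.
apply/ler_addgt0Pr => eps eps0.
pose e := eps / (1 + M); have e0 : 0 < e by rewrite divr_gt0//; lra.
have [y [yr yq]] : (N e `&` ball q e) !=set0.
  apply: (@filter_ex _ F); apply: filterI; first by exists e.
  by apply: Fq; exact: nbhsx_ballx.
rewrite ballEmdist/= in yq.
have := weighted_radius_lipschitz q y wu sP uM.
have : M * mdist q y <= M * e by rewrite ler_pM2l// ltW.
have : e * (1 + M) = eps by rewrite divfK//; lra.
by move: yr; rewrite /N/=; clear; lra.
Qed.

Lemma barycenterP P u (Delta sigma : R) : weight P u ->
  small_spread P Delta sigma ->
  weighted_radius P u (barycenter P u) = baryradius P u.
Proof.
move=> wu tP; have [q hq] := barycenter_exists wu tP.
suff : unique (is_barycenter P u) (barycenter P u) by case.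
apply: getPex; exists q; split => // y hy.
apply/eqP/negPn; rewrite -mdist_gt0; apply/negP => qy0.
have [eta eta0 close] := near_minimizers_close wu tP qy0.
by have := close q y; rewrite hq hy lerDl ltW// ltxx => /(_ isT isT).
Qed.

End Barycenters.

(** * Perturbing the weight and the set *)

Section Perturbation.
Context {R : realType} {X : completeMetricType R}.
Implicit Types (P : set X) (u v : X -> R) (x y q : X).

Lemma small_spread_of_diameter (k : R) P :
  (diameter P < 4^-1%:E * model_diameter k)%E ->
  exists Delta sigma, small_spread k P Delta sigma.
Proof.
move=> hP; have Dk0 : (0 < model_diameter k)%E.
  rewrite /model_diameter; case: ifPn => // k0.
  by rewrite lte_fin divr_gt0 ?pi_gt0 ?sqrtr_gt0.
have dP p q : P p -> P q -> ((mdist p q)%:E <= diameter P)%E.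
  by move=> Pp Pq; apply: ereal_sup_ubound; exists p => //; exists q.
have finP : (diameter P < +oo)%E.
  by apply: (lt_le_trans hP); exact: leey.
pose Delta := Num.max 0 (fine (diameter P)).
have sP : spread P Delta.
  move=> p q Pp Pq; rewrite le_max; apply/orP; right.
  move: (dP p q Pp Pq) finP; case: (diameter P) => [r| |] //.
have Delta0 : 0 <= Delta by rewrite le_max lexx.
have : (Delta%:E < 4^-1%:E * model_diameter k)%E.
  rewrite /Delta; case: (leP 0 (fine (diameter P))) => [f0|_]; last first.
    by rewrite mule_gt0.
  move: f0 hP finP; case: (diameter P) => [r| |] //= _ _ _.
  by rewrite mule_gt0.
rewrite /small_spread; move: Dk0; rewrite /model_diameter; case: ifP => _ _.
  rewrite -EFinM lte_fin => hD; set D := pi / Num.sqrt k in hD *.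
  exists Delta, ((D / 2 - 2 * Delta) / 2); split => //; first by lra.
  by rewrite lte_fin; lra.
by move=> _; exists Delta, 1; split; rewrite ?ltry.
Qed.

(** The bound requires [q] to be near [P], where the error in the weight is
    multiplied by a bounded distance. *)
Lemma weighted_radius_weight_stable P u u' (Delta rho delta : R) q :
  weight P u -> weight P u' -> spread P Delta ->
  (forall p, P p -> `|u p - u' p| < delta) ->
  (forall p, P p -> mdist q p <= rho) ->
  weighted_radius P u' q <= weighted_radius P u q + delta * rho.
Proof.
move=> wu wu' sP du dq; apply: weighted_radius_le => // p Pp.
have := le_weighted_radius q wu sP Pp.
have : (u' p - u p) * mdist q p <= delta * rho.
  apply: le_trans (ler_norm _) _; rewrite normrM distrC.
  apply: ler_pM; rewrite ?normr_ge0 ?(ltW (du _ Pp))//.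
  by rewrite ger0_norm ?mdist_ge0 ?dq.
by lra.
Qed.

Lemma le_pushforward_weight P (f : X -> X) u p : weight P u -> P p ->
  u p <= pushforward_weight P f u (f p).
Proof.
move=> wu Pp; have [M _ uM] := weight_bound wu; apply: ub_le_sup; last by exists p.
by exists M => _ [p' [Pp' _] <-]; exact: uM.
Qed.

Lemma pushforward_weight_le P (f : X -> X) u (b : R) p : P p ->
  (forall p', P p' -> f p' = f p -> u p' <= b) ->
  pushforward_weight P f u (f p) <= b.
Proof.
move=> Pp h; apply: ge_sup; first by exists (u p), p.
by move=> _ [p' [Pp' fp'] <-]; exact: h.
Qed.

Lemma weight_pushforward P (f : X -> X) u : weight P u ->
  weight (f @` P) (pushforward_weight P f u).
Proof.
move=> wu; have [u0 _ _] := wu; have [M M0 uM] := weight_bound wu.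
have v0 p : P p -> 0 <= pushforward_weight P f u (f p).
  by move=> Pp; apply: le_trans (le_pushforward_weight f wu Pp); exact: u0.
split.
- by move=> _ [p Pp <-]; exact: v0.
- exists M; split; first exact: num_real.
  move=> b Mb _ [p Pp <-] /=; rewrite ger0_norm ?v0//.
  by apply: pushforward_weight_le => // p' Pp' _; exact: le_trans (uM _ Pp') (ltW Mb).
- have [p Pp up] := weight_gt0 wu; exists (f p); first by exists p.
  by rewrite gt_eqF// (lt_le_trans up)// le_pushforward_weight.
Qed.

Lemma spread_image P (f : X -> X) (Delta delta : R) : spread P Delta ->
  delta_function P delta f -> spread (f @` P) (Delta + 2 * delta).
Proof.
move=> sP df _ _ [p Pp <-] [q Pq <-].
have := metric_triangle (f p) p (f q); have := metric_triangle p q (f q).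
rewrite (metric_sym (f p) p).
by have := df p Pp; have := df q Pq; have := sP p q Pp Pq; lra.
Qed.

(** Up to the displacement, both sides are the supremum over [P] of
    [u p * mdist x (f p)]: the pushforward weight takes the supremum over each
    fiber of [f] first. *)
Lemma weighted_radius_pushforward P (f : X -> X) u (Delta delta M : R) x :
  weight P u -> spread P Delta -> delta_function P delta f ->
  (forall p, P p -> u p <= M) ->
  let v := pushforward_weight P f u in
  weighted_radius (f @` P) v x <= weighted_radius P u x + M * delta /\
  weighted_radius P u x <= weighted_radius (f @` P) v x + M * delta.
Proof.
move=> wu sP df uM v; have wv := weight_pushforward f wu.
have sfP := spread_image sP df; have [u0 _ _] := wu.
have move_le p : P p -> u p * mdist p (f p) <= M * delta.
  by move=> Pp; apply: ler_pM; rewrite ?u0 ?mdist_ge0 ?uM ?(ltW (df p Pp)).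
split; apply: weighted_radius_le => //.
  move=> _ [p Pp <-]; set b := _ + _.
  have ub p' : P p' -> f p' = f p -> u p' * mdist x (f p) <= b.
    move=> Pp' <-; have := le_weighted_radius x wu sP Pp'.
    have := ler_wpM2l (u0 _ Pp') (metric_triangle x p' (f p')).
    by have := move_le _ Pp'; rewrite /b; lra.
  (* Multiplication by a positive distance commutes with the supremum defining
     the pushforward weight; distance zero is separate. *)
  have := mdist_ge0 x (f p); rewrite le_eqVlt => /predU1P[d0|d0].
    by have := ub p Pp erefl; rewrite -d0 !mulr0.
  rewrite -ler_pdivlMr//; apply: pushforward_weight_le => // p' Pp' fp'.
  by rewrite ler_pdivlMr// ub.
move=> p Pp; have fPp : (f @` P) (f p) by exists p.
have := le_weighted_radius x wv sfP fPp; rewrite -/v.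
have := ler_wpM2r (mdist_ge0 x (f p)) (le_pushforward_weight f wu Pp).
have := ler_wpM2l (u0 _ Pp) (metric_triangle x (f p) p); rewrite (metric_sym (f p)).
by have := move_le _ Pp; rewrite -/v; lra.
Qed.

End Perturbation.

Theorem theorem2 (R : realType) (k : R) (X : completeMetricType R)
    (hX : CAT k X) (P : set X)
    (hP : (diameter P < 4^-1%:E * model_diameter k)%E) :
  [/\
    forall eps : R, 0 < eps -> exists2 delta : R, 0 < delta &
      forall u u' : X -> R, weight P u -> weight P u' ->
        (forall p, P p -> `|u p - u' p| < delta) ->
        `|baryradius P u - baryradius P u'| < eps,
    forall (u : X -> R) (eps : R), weight P u -> 0 < eps ->
      exists2 delta : R, 0 < delta &
        forall u' : X -> R, weight P u' ->
          (forall p, P p -> `|u p - u' p| < delta) ->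
          mdist (barycenter P u) (barycenter P u') < eps
  & forall (u : X -> R) (eps : R), weight P u -> 0 < eps ->
      exists2 delta : R, 0 < delta &
        forall f : X -> X, delta_function P delta f ->
          let P' := f @` P in
          let v := pushforward_weight P f u in
          mdist (barycenter P' v) (barycenter P u) < eps /\
          `|baryradius P' v - baryradius P u| < eps ].
Proof.
have [Delta [sigma tP]] := small_spread_of_diameter hP.
have [sP Delta0 sigma0 rho_Dk] := tP; pose rho := 2 * Delta + sigma.
have rho0 : 0 < rho by rewrite /rho; lra.
have bary_loc u : weight P u -> forall p, P p -> mdist (barycenter P u) p <= rho.
  move=> wu; have [eta eta0 loc] := near_minimizer_localized wu sP sigma0.
  by apply: loc; rewrite (barycenterP hX wu tP) lerDl ltW.
have stable u u' (delta : R) : weight P u -> weight P u' ->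
    (forall p, P p -> `|u p - u' p| < delta) ->
    weighted_radius P u (barycenter P u') <= baryradius P u' + delta * rho.
  move=> wu wu' du; rewrite -(barycenterP hX wu' tP).
  apply: (weighted_radius_weight_stable wu' wu sP) (bary_loc _ wu').
  by move=> p Pp; rewrite distrC du.
have radius_stable u u' (delta : R) : weight P u -> weight P u' ->
    (forall p, P p -> `|u p - u' p| < delta) ->
    baryradius P u <= baryradius P u' + delta * rho.
  move=> wu wu' du; apply: le_trans (stable _ _ _ wu wu' du).
  exact: baryradius_le wu sP.
have flip (u u' : X -> R) (delta : R) :
    (forall p, P p -> `|u p - u' p| < delta) ->
    forall p, P p -> `|u' p - u p| < delta.
  by move=> du p Pp; rewrite distrC du.
split.
- move=> eps eps0; exists (eps / (2 * rho)); first by rewrite divr_gt0// mulr_gt0.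
  move=> u u' wu wu' du.
  have := radius_stable _ _ _ wu wu' du.
  have := radius_stable _ _ _ wu' wu (flip _ _ _ du).
  have -> : eps / (2 * rho) * rho = eps / 2 by field; rewrite gt_eqF.
  by rewrite ltr_norml; lra.
- move=> u eps wu eps0.
  have [eta eta0 close] := near_minimizers_close hX wu tP eps0.
  exists (eta / (2 * rho)); first by rewrite divr_gt0// mulr_gt0.
  move=> u' wu' du; apply: close.
    by rewrite (barycenterP hX wu tP) lerDl ltW.
  have := stable _ _ _ wu wu' du.
  have := radius_stable _ _ _ wu' wu (flip _ _ _ du).
  have -> : eta / (2 * rho) * rho = eta / 2 by field; rewrite gt_eqF.
  by lra.
move=> u eps wu eps0; have [M M0 uM] := weight_bound wu.
have [eta eta0 close] := near_minimizers_close hX wu tP eps0.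
pose delta := Num.min (sigma / 8) (Num.min (eta / (2 * M)) (eps / (2 * M))).
have delta0 : 0 < delta by rewrite !lt_min !divr_gt0// mulr_gt0.
have delta_sigma : delta <= sigma / 8 by rewrite ge_min lexx.
have delta_eta : M * delta <= eta / 2.
  have -> : eta / 2 = M * (eta / (2 * M)) by field; rewrite gt_eqF.
  by rewrite ler_pM2l// !ge_min lexx orbT.
have delta_eps : M * delta <= eps / 2.
  have -> : eps / 2 = M * (eps / (2 * M)) by field; rewrite gt_eqF.
  by rewrite ler_pM2l// !ge_min lexx !orbT.
exists delta => // f df P' v.
have wv := weight_pushforward f wu.
have tP' : small_spread k P' (Delta + 2 * delta) (sigma / 2).
  split; [exact: spread_image| lra | lra |].
  by apply: le_lt_trans rho_Dk; rewrite lee_fin; lra.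
have [sP' _ _ _] := tP'.
have rad x := weighted_radius_pushforward x wu sP df uM.
have [/= _ rq'] := rad (barycenter P' v); have [/= rq _] := rad (barycenter P u).
rewrite -/P' -/v (barycenterP hX wv tP') in rq'.
rewrite -/P' -/v (barycenterP hX wu tP) in rq.
have := baryradius_le (barycenter P u) wv sP'; rewrite -/P' -/v => rv.
have ru := baryradius_le (barycenter P' v) wu sP.
split; last by rewrite ltr_norml; lra.
apply: close; last by rewrite (barycenterP hX wu tP) lerDl ltW.
lra.
Qed.
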